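(* Let $s,t$ be integers, let $(U_n)_{n\ge 0}$ be the Lucas sequence and $(P_n)_{n\ge 1}$ the sequence of Lucas atoms associated with $(s,t)$. Let $p\geq 3$ be a prime number with $p\nmid t$, and let $k=\rho(p,U)$ be the rank of appearance of $p$ in $(U_n)_{n\ge 0}$. Then for every integer $n\ge 1$, \[ v_p(P_n)=\begin{cases} v_p(U_k) & \text{if } n=k,\\ 1 & \text{if } n=kp^h \text{ for some integer } h\geq 1,\\ 0 & \text{otherwise.}\end{cases} \]
   Context: Lucas sequence: for integers $s,t$, $U_0=0$, $U_1=1$, $U_n=sU_{n-1}+tU_{n-2}$ for $n\ge 2$. Lucas atoms: for $n\ge 1$ let $\Phi_n(\alpha,\beta)=\prod_{1\le j\le n,\ \gcd(j,n)=1}(\alpha-\omega^j\beta)$, with $\omega$ a primitive $n$-th root of unity (the homogenization of the $n$-th cyclotomic polynomial). Put $P_1(s,t)=1$, and for $n\ge 2$ let $P_n(s,t)\in\mathbb Z[s,t]$ be the unique polynomial with $P_n(\alpha+\beta,-\alpha\beta)=\Phi_n(\alpha,\beta)$ as polynomials in the variables $\alpha,\beta$. For integers $s,t$, $P_n$ denotes the integer value $P_n(s,t)$. The rank of appearance $\rho(p,U)$ is the least integer $k\ge 1$ with $p\mid U_k$ (it exists when $p\nmid t$). $v_p$ is the $p$-adic valuation, with $v_p(0)=+\infty$. *)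

(* Defs.v *)
From mathcomp Require Import all_boot all_order all_algebra all_field.
From mathcomp Require Import perm mpoly.

Set Implicit Arguments.
Unset Strict Implicit.
Unset Printing Implicit Defensive.

Import GRing.Theory Num.Theory.
Local Open Scope ring_scope.

Fixpoint lucasU (s t : int) (n : nat) : int :=
  match n with
  | 0 => 0
  | 1 => 1
  | (n'.+1 as m).+1 => s * lucasU s t m + t * lucasU s t n'
  end.

(* The two variables alpha and beta are 'X_0 and 'X_1. *)
Definition homPhi (n : nat) (w : algC) : {mpoly algC[2]} :=
  \prod_(1 <= j < n.+1 | coprime j n) ('X_0 - w ^+ j *: 'X_1).

(* The variables s and t of P are also 'X_0 and 'X_1. For n >= 2 the identity
   P(alpha + beta, - alpha beta) = Phi_n(alpha, beta) is stated over algC,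
   where the roots of unity live. *)
Definition is_lucas_atom (n : nat) (P : {mpoly int[2]}) : Prop :=
  (n = 1%N -> P = 1) /\
  ((1 < n)%N -> forall w : algC, n.-primitive_root w ->
     map_mpoly intr P \mPo [tuple 'X_0 + 'X_1; - ('X_0 * 'X_1)] = homPhi n w).

Section Homogenization.

Variable R : comNzRingType.

Let hom (d : nat) (q : {poly R}) : {mpoly R[2]} :=
  \sum_(i < d.+1) q`_i *: ('X_0 ^+ i * 'X_1 ^+ (d - i)).

Lemma hom_XsubC d (q : {poly R}) r : (size q <= d.+1)%N ->
  hom d.+1 (('X - r%:P) * q) = ('X_0 - r *: 'X_1) * hom d q.
Proof.
move=> sq; rewrite mulrBl mulrBl.
have ->: hom d.+1 ('X * q - r%:P * q) = hom d.+1 ('X * q) - hom d.+1 (r%:P * q).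
  by rewrite /hom -sumrB; apply: eq_bigr => i _; rewrite coefB scalerBl.
congr (_ - _).
  rewrite /hom big_ord_recl coefXM /= scale0r add0r mulr_sumr.
  apply: eq_bigr => i _; rewrite coefXM /= /bump /= add1n /= subSS exprS.
  by rewrite -scalerAr mulrA.
rewrite /hom big_ord_recr /= coefCM nth_default // mulr0 scale0r addr0.
rewrite mulr_sumr; apply: eq_bigr => i _.
rewrite coefCM -scalerAl -scalerAr scalerA subSn -1?ltnS // exprS.
by rewrite mulrCA.
Qed.

Lemma hom_prod (rs : seq R) :
  hom (size rs) (\prod_(r <- rs) ('X - r%:P)) =
  \prod_(r <- rs) ('X_0 - r *: 'X_1).
Proof.
elim: rs => [|r rs IH].
  by rewrite !big_nil /hom big_ord1 coef1 /= !expr0 mulr1 scale1r.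
by rewrite !big_cons hom_XsubC ?IH // size_prod_XsubC.
Qed.

End Homogenization.

Lemma Cyclotomic_at0 n : (1 < n)%N -> (Cyclotomic n).[0] = 1.
Proof.
have h1 : (Cyclotomic 1).[0] = -1.
  have /(congr1 (horner^~ 0)) := prod_Cyclotomic (isT : 0 < 1)%N.
  by rewrite big_seq1 !hornerE.
elim/ltn_ind: n => n IH n1; have n0 := ltnW n1.
have [uD _ inD] := divisors_correct n0.
have /(congr1 (horner^~ 0)) := prod_Cyclotomic n0.
rewrite horner_prod (big_rem n) ?inD //= (big_rem 1%N) /=; last first.
  by rewrite mem_rem_uniq // !inE inD dvd1n ltn_eqF.
rewrite big_seq big1 ?h1 => [|d].
  rewrite mulr1 mulrN1 hornerD hornerXn hornerN hornerC expr0n gtn_eqF //=.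
  by rewrite add0r => /oppr_inj.
rewrite mem_rem_uniq ?rem_uniq // inE mem_rem_uniq // inE inD.
case/and3P=> d1 dn dv; apply: IH.
  by rewrite ltn_neqAle dn dvdn_leq.
by rewrite ltn_neqAle eq_sym d1 (dvdn_gt0 n0 dv).
Qed.

Lemma homPhi_ord n w : (1 < n)%N ->
  homPhi n w = \prod_(k < n | coprime k n) ('X_0 - w ^+ k *: 'X_1).
Proof.
move=> n1; rewrite /homPhi big_mkcond big_nat_recr ?(ltnW n1) //=.
rewrite /coprime gcdnn gtn_eqF // mulr1 -big_mkcond.
rewrite -(big_mkord (fun k => gcdn k n == 1)%N
  (fun k => 'X_0 - w ^+ k *: 'X_1 : {mpoly algC[2]})).
by rewrite [RHS]big_mkcond big_ltn 1?ltnW // gcd0n gtn_eqF //= mul1r -big_mkcond.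
Qed.

Definition intHomPhi n : {mpoly int[2]} :=
  \sum_(i < (totient n).+1)
     (Cyclotomic n)`_i *: ('X_0 ^+ i * 'X_1 ^+ (totient n - i)).

Lemma map_intHomPhi n w : (1 < n)%N -> n.-primitive_root w ->
  map_mpoly intr (intHomPhi n) = homPhi n w.
Proof.
move=> n1 pw; rewrite homPhi_ord //.
pose rs := [seq w ^+ val k | k <- enum [pred k : 'I_n | coprime k n]].
have E : cyclotomic w n = \prod_(r <- rs) ('X - r%:P).
  by rewrite big_map big_enum /=; apply: eq_bigl => k; rewrite inE.
have Es : size rs = totient n.
  by apply: succn_inj; rewrite -(size_cyclotomic w) E size_prod_XsubC.
have -> : \prod_(k < n | coprime k n) ('X_0 - w ^+ k *: 'X_1) =
          \prod_(r <- rs) ('X_0 - r *: 'X_1) :> {mpoly algC[2]}.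
  by rewrite big_map big_enum /=; apply: eq_bigl => k; rewrite inE.
rewrite -hom_prod Es -E -(Cintr_Cyclotomic pw) raddf_sum /=.
apply: eq_bigr => i _.
by rewrite map_mpolyZ coef_map /= rmorphM !rmorphXn /= !map_mpolyX.
Qed.

Lemma homPhi_swap n w (s : 'S_2) : (1 < n)%N -> n.-primitive_root w ->
  msym s (homPhi n w) = homPhi n w.
Proof.
move=> n1 pw; have n0 := ltnW n1.
have w0 : w != 0 by rewrite (prim_root_eq0 pw) -lt0n.
have msymX i : msym s 'X_i = 'X_(s i) :> {mpoly algC[2]}.
  by rewrite msymX; congr 'X_[_]; apply/mnmP => j; rewrite !mnmE -(inj_eq (@perm_inj _ s)) permKV.
case: (altP (s 0 =P 0)) => s0.
  have s1 : s 1 = 1.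
    have : s 1 != s 0 by rewrite (inj_eq perm_inj).
    by rewrite s0; case: (s 1) => -[|[|//]] // ? _; apply: val_inj.
  rewrite rmorph_prod /=; apply: eq_bigr => j _.
  by rewrite msymB msymZ !msymX s0 s1.
have s0' : s 0 = 1 by move: s0; case: (s 0) => -[|[|//]] // ? _; apply: val_inj.
have s1' : s 1 = 0.
  have : s 1 != s 0 by rewrite (inj_eq perm_inj).
  by rewrite s0'; case: (s 1) => -[|[|//]] // ? _; apply: val_inj.
have pV : n.-primitive_root w^-1.
  have -> : w^-1 = w ^+ n.-1.
    by apply: (mulfI w0); rewrite divff // -exprS prednK // prim_expr_order.
  by rewrite prim_root_exp_coprime // coprime_sym coprimenP.
rewrite -{2}(map_intHomPhi n1 pw) (map_intHomPhi n1 pV) !homPhi_ord //.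
rewrite rmorph_prod /=.
transitivity (\prod_(k < n | coprime k n)
   ((- w ^+ k)%:MP * ('X_0 - w^-1 ^+ k *: 'X_1)) : {mpoly algC[2]}).
  apply: eq_bigr => k _; rewrite msymB msymZ !msymX s0' s1'.
  rewrite mul_mpolyC scalerBr scalerA scaleNr mulNr exprVn divff ?expf_neq0 //.
  by rewrite scaleN1r opprK addrC.
rewrite big_split /= -[X in X * _]rmorph_prod /=.
have -> : \prod_(k < n | coprime k n) (- w ^+ k) = 1.
  have : (cyclotomic w n).[0] = 1.
    rewrite -(Cintr_Cyclotomic pw) -(rmorph0 (intr : int -> algC)) horner_map /=.
    by rewrite Cyclotomic_at0.
  rewrite /cyclotomic horner_prod => {2}<-.
  by apply: eq_bigr => k _; rewrite !hornerE.
by rewrite mul1r.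
Qed.

Lemma map_mpoly_intr_inj (n : nat) :
  injective (map_mpoly (intr : int -> algC) : {mpoly int[n]} -> _).
Proof.
move=> p q /mpolyP e; apply/mpolyP => m; move: (e m).
by rewrite !mcoeff_map_mpoly => /intr_inj.
Qed.

Lemma comp_mpolyA (R : comNzRingType) n k l (p : {mpoly R[n]})
    (q : n.-tuple {mpoly R[k]}) (r : k.-tuple {mpoly R[l]}) :
  (p \mPo q) \mPo r = p \mPo [tuple of [seq x \mPo r | x <- q]].
Proof.
rewrite (comp_mpolyEX p) raddf_sum /= [RHS]comp_mpolyEX.
apply: eq_bigr => m _; rewrite comp_mpolyZ; congr (_ *: _).
rewrite !comp_mpolyX rmorph_prod; apply: eq_bigr => i _ /=.
by rewrite rmorphXn /= tnth_map.
Qed.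

Local Notation sgn_sub := [tuple 'X_0 : {mpoly int[2]}; - 'X_1].
Local Notation lucas_sub R :=
  [tuple 'X_0 + 'X_1 : {mpoly R[2]}; - ('X_0 * 'X_1)].

Lemma sgn_lucas_sub (p : {mpoly int[2]}) :
  (p \mPo sgn_sub) \mPo lucas_sub int = p \mPo [tuple mesym 2 int i.+1 | i < 2].
Proof.
rewrite comp_mpolyA; congr (p \mPo _); apply: eq_from_tnth => i.
rewrite tnth_map tnth_mktuple.
case: i => -[|[|//]] lt_i.
  by rewrite (tnth_nth 0) /= comp_mpolyXU /= mesym1E big_ord_recl big_ord1;
     congr (_ + 'X_ _); apply: val_inj.
rewrite (tnth_nth 0) /= comp_mpolyN comp_mpolyXU /= opprK.
by rewrite (mesymnnE 2 int) big_ord_recl big_ord1;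
   congr (_ * 'X_ _); apply: val_inj.
Qed.

Lemma sgn_subK (p : {mpoly int[2]}) : (p \mPo sgn_sub) \mPo sgn_sub = p.
Proof.
rewrite comp_mpolyA -[RHS]comp_mpoly_id; congr (p \mPo _).
apply: eq_from_tnth => i; rewrite tnth_map tnth_mktuple.
case: i => -[|[|//]] lt_i; rewrite (tnth_nth 0) /=.
  by rewrite comp_mpolyXU /=; congr 'X_ _; apply: val_inj.
by rewrite comp_mpolyN comp_mpolyXU /= opprK; congr 'X_ _; apply: val_inj.
Qed.

Lemma map_lucas_sub (p : {mpoly int[2]}) :
  map_mpoly intr p \mPo lucas_sub algC =
  map_mpoly (intr : int -> algC) (p \mPo lucas_sub int).
Proof.
rewrite map_mpoly_comp; last exact: intr_inj.
congr (_ \mPo _); apply: eq_from_tnth => i; rewrite tnth_map.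
case: i => -[|[|//]] lt_i; rewrite !(tnth_nth 0) /=.
  by rewrite rmorphD /= !map_mpolyX.
by rewrite rmorphN rmorphM /= !map_mpolyX.
Qed.

Lemma lucas_atom_exists (n : nat) : {P : {mpoly int[2]} | is_lucas_atom n P}.
Proof.
case: (ltnP 1 n) => n1; last first.
  by exists 1; split => //; rewrite ltnNge n1.
have symH : intHomPhi n \is symmetric.
  apply/issymP => s; have [w pw] := C_prim_root_exists (ltnW n1).
  have h := homPhi_swap s n1 pw; rewrite -(map_intHomPhi n1 pw) in h.
  apply/mpolyP => m; move/mpolyP/(_ m): h.
  by rewrite mcoeff_sym !mcoeff_map_mpoly mcoeff_sym => /intr_inj.
have [T [hT _]] := sym_fundamental symH.
exists (T \mPo sgn_sub); split=> [n1'|_ w pw]; first by rewrite n1' in n1.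
by rewrite map_lucas_sub sgn_lucas_sub hT (map_intHomPhi n1 pw).
Qed.

Lemma lucas_atom_unique (n : nat) (P Q : {mpoly int[2]}) :
  (0 < n)%N -> is_lucas_atom n P -> is_lucas_atom n Q -> P = Q.
Proof.
move=> n0 [P1 Pn] [Q1 Qn]; case: (ltnP 1 n) => n1; last first.
  by have e : n = 1%N by [apply/eqP; rewrite eqn_leq n1]; rewrite P1 ?Q1.
have [w pw] := C_prim_root_exists n0.
have := Pn n1 w pw; rewrite -(Qn n1 w pw) !map_lucas_sub => /map_mpoly_intr_inj e.
have : (P - Q) \mPo lucas_sub int = 0 by rewrite comp_mpolyB e subrr.
rewrite -{1}(sgn_subK (P - Q)) sgn_lucas_sub => /msym_fundamental_un0 h.
by apply/eqP; rewrite -subr_eq0 -(sgn_subK (P - Q)) h raddf0.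
Qed.

Definition lucas_atom_poly (n : nat) : {mpoly int[2]} :=
  sval (lucas_atom_exists n).

Definition lucasP (s t : int) (n : nat) : int :=
  (lucas_atom_poly n).@[tnth [tuple s; t]].

Definition is_rank (p : nat) (U : nat -> int) (k : nat) : Prop :=
  [/\ (0 < k)%N, (p %| U k)%Z &
      forall j : nat, (0 < j)%N -> (p %| U j)%Z -> (k <= j)%N].

Lemma rank_exists (p : nat) (s t : int) : prime p -> ~~ (p %| t)%Z ->
  exists k, is_rank p (lucasU s t) k.
Proof.
move=> pp pt.
have dvdF (x : int) : (p %| x)%Z = (x%:~R == 0 :> 'F_p).
  have natF (m : nat) : (p %| m)%N = (m%:R == 0 :> 'F_p).
    by rewrite (dvdn_pcharf (pchar_Fp pp)).
  by rewrite unfold_in /= natF; case: x => m //=; rewrite NegzE rmorphN oppr_eq0.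
have t0 : t%:~R != 0 :> 'F_p by rewrite -dvdF.
pose f (x : 'F_p * 'F_p) := (x.2, s%:~R * x.2 + t%:~R * x.1 : 'F_p).
have injf : injective f.
  move=> [a b] [c d] e; have /= e2 := congr1 snd e.
  move: e e2 => /(congr1 fst)/= -> /addrI/(mulfI t0) -> //.
have it n : iter n f (0, 1) = ((lucasU s t n)%:~R, (lucasU s t n.+1)%:~R).
  by elim: n => [|n IH] //; rewrite iterS IH /f /= rmorphD !rmorphM.
have ex : exists k, (0 < k)%N && (p %| lucasU s t k)%Z.
  exists (fingraph.order f (0, 1)); rewrite order_gt0 dvdF /=.
  by have /(congr1 fst) := fingraph.iter_order injf (0, 1); rewrite it /= => ->.
case: (ex_minnP ex) => k /andP[k0 kd] kmin; exists k; split=> // j j0 jd.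
by apply: kmin; rewrite j0.
Qed.

(* [None] is the value +oo, taken at 0 only. *)
Definition vp (p : nat) (x : int) : option nat :=
  if x == 0 then None else Some (logn p `|x|%N).

(* Main.v *)
Require Import Defs.
From mathcomp Require Import all_boot all_order all_algebra.
From mathcomp Require Import all_field mpoly ring.

(* Let V be the companion sequence, V_m = alpha^m + beta^m. Factoring
   (alpha^(mq) - beta^(mq)) / (alpha^m - beta^m) into cyclotomic polynomials
   shows that the product of the P_d over the d dividing mq but not m is the
   q-th term of the Lucas sequence with parameters V_m and -(-t)^m. If p | U_m,
   the discriminant V_m^2 - 4(-t)^m = (s^2 + 4t) U_m^2 of that sequence is
   divisible by p^2, and its q-th term W satisfies
   2^(q-1) W = q V_m^(q-1) modulo p^2. Hence, for q prime, W has p-adic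
   valuation 1 if q = p and 0 otherwise. As p | P_d forces k | d, the cases
   (m, q) = (1, k), (k p^(h-1), p) and (n/q, q), where q <> p is a prime factor
   of n/k, give the three values. No division by U_m occurs, so U_m = 0 is
   allowed. *)

Import GRing.Theory Num.Theory.
Local Open Scope ring_scope.

(** * Integer identities for the Lucas sequence and its companion *)

Definition lucasV (s t : int) (n : nat) : int :=
  2 * lucasU s t n.+1 - s * lucasU s t n.

Lemma lucasUSS s t n :
  lucasU s t n.+2 = s * lucasU s t n.+1 + t * lucasU s t n.
Proof. by []. Qed.

Lemma lucasUD s t m n :
  lucasU s t (m + n).+1 =
  lucasU s t m.+1 * lucasU s t n.+1 + t * lucasU s t m * lucasU s t n.
Proof.
suff [] : lucasU s t (m + n).+1 =
    lucasU s t m.+1 * lucasU s t n.+1 + t * lucasU s t m * lucasU s t n /\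
  lucasU s t (m + n).+2 =
    lucasU s t m.+1 * lucasU s t n.+2 + t * lucasU s t m * lucasU s t n.+1.
  by [].
elim: n => [|n [IH1 IH2]].
  by rewrite addn0 !lucasUSS /=; split; ring.
by rewrite !addnS !(lucasUSS _ _ (_ + _).+1) IH2 IH1 !lucasUSS; split; ring.
Qed.

(** With [alpha], [beta] the roots of [X^2 - s X - t], this is the norm of
    [alpha^n = U_(n+1) - beta U_n]. *)
Lemma lucasU_cassini s t n :
  lucasU s t n.+1 ^+ 2 - s * lucasU s t n.+1 * lucasU s t n
    - t * lucasU s t n ^+ 2 = (- t) ^+ n.
Proof.
elim: n => [|n IH]; first by rewrite /= expr0; ring.
by rewrite [RHS]exprS -IH lucasUSS; ring.
Qed.

Lemma lucasV_discriminant s t n :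
  lucasV s t n ^+ 2 + 4 * (- (- t) ^+ n)
    = (s ^+ 2 + 4 * t) * lucasU s t n ^+ 2.
Proof. by rewrite -(lucasU_cassini s t n) /lucasV; ring. Qed.

(* The classical congruence 2^(n-1) U_n = n a^(n-1) modulo a^2 + 4b, multiplied
   by 2a to avoid the exponents n - 1. *)
Lemma lucasU_mod_discriminant a b n :
  (a ^+ 2 + 4 * b %| a * 2 ^+ n * lucasU a b n - 2 * n%:R * a ^+ n)%Z.
Proof.
suff [] : (a ^+ 2 + 4 * b %| a * 2 ^+ n * lucasU a b n - 2 * n%:R * a ^+ n)%Z /\
  (a ^+ 2 + 4 * b %|
     a * 2 ^+ n.+1 * lucasU a b n.+1 - 2 * n.+1%:R * a ^+ n.+1)%Z by [].
elim: n => [|n [/dvdzP[x Hx] /dvdzP[y Hy]]].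
  by split; apply/dvdzP; exists 0; rewrite /=; ring.
split; first by rewrite Hy dvdz_mull.
(* If [E_n] is the difference to be divided, the recurrence gives [E_(n+2) = 2a E_(n+1) + 4b E_n +
   2n a^n (a^2 + 4b)]. *)
apply/dvdzP; exists (2 * a * y + 4 * b * x + 2 * n%:R * a ^+ n).
transitivity (2 * a * (y * (a ^+ 2 + 4 * b)) + 4 * b * (x * (a ^+ 2 + 4 * b)) +
  2 * n%:R * a ^+ n * (a ^+ 2 + 4 * b)); last by ring.
by rewrite -Hx -Hy lucasUSS !exprS -!natr1; ring.
Qed.

(** * Binet formulas *)

(** The sum replaces the quotient [(a^n - b^n) / (a - b)], so that a double root [a = b] is
    covered. *)
Lemma lucasU_binet (a b : algC) (s t : int) n :
  a + b = s%:~R -> a * b = - t%:~R ->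
  (lucasU s t n)%:~R = \sum_(i < n) a ^+ (n.-1 - i) * b ^+ i.
Proof.
move=> abs abt.
suff [] : (lucasU s t n)%:~R = \sum_(i < n) a ^+ (n.-1 - i) * b ^+ i /\
  (lucasU s t n.+1)%:~R = \sum_(i < n.+1) a ^+ (n - i) * b ^+ i by [].
have rec m : \sum_(i < m.+1) a ^+ (m - i) * b ^+ i =
   a * (\sum_(i < m) a ^+ (m.-1 - i) * b ^+ i) + b ^+ m.
  rewrite big_ord_recr /= subnn mul1r mulr_sumr; congr (_ + _).
  apply: eq_bigr => i _; rewrite mulrA -exprS; congr (a ^+ _ * _).
  by case: m i => [[]//|m] i; rewrite subSn // -ltnS.
elim: n => [|n [IH1 IH2]]; first by rewrite big_ord0 big_ord1 /= !expr0 mulr1.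
split=> //; rewrite lucasUSS rmorphD !rmorphM /= -abs -[t%:~R]opprK -abt.
by rewrite IH2 IH1 2!rec /= !rec /= exprS; ring.
Qed.

Lemma lucasV_binet (a b : algC) (s t : int) n :
  a + b = s%:~R -> a * b = - t%:~R -> a ^+ n + b ^+ n = (lucasV s t n)%:~R.
Proof.
move=> abs abt.
suff [] : a ^+ n + b ^+ n = (lucasV s t n)%:~R /\
   a ^+ n.+1 + b ^+ n.+1 = (lucasV s t n.+1)%:~R by [].
have rec m : lucasV s t m.+2 = s * lucasV s t m.+1 + t * lucasV s t m.
  by rewrite /lucasV !lucasUSS; ring.
elim: n => [|n [IH1 IH2]].
  rewrite /lucasV /= !expr0 !expr1 abs; split.
    by rewrite mulr1 mulr0 subr0.
  by congr _%:~R; ring.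
split=> //; rewrite rec rmorphD !rmorphM /= -IH1 -IH2 -abs -[t%:~R]opprK -abt.
by rewrite !exprS; ring.
Qed.

(** * Atoms as values of cyclotomic polynomials *)

Lemma meval_map_mpoly (R S : comNzRingType) (f : {rmorphism R -> S}) n
    (p : {mpoly R[n]}) (v : 'I_n -> R) :
  (map_mpoly f p).@[fun i => f (v i)] = f p.@[v].
Proof.
rewrite [X in f X]mevalE rmorph_sum /= /map_mpoly /mmap raddf_sum /=.
apply: eq_bigr => m _; rewrite mmap1_id mul_mpolyC mevalZ mevalX rmorphM.
by rewrite rmorph_prod /=; under [in RHS]eq_bigr do rewrite rmorphXn.
Qed.

(** Evaluate the defining identity of the atom at [(a, b)], then dehomogenize by dividing by [b]. *)
Lemma lucasP_Cyclotomic (a b : algC) (s t : int) n :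
  a + b = s%:~R -> a * b = - t%:~R -> b != 0 -> (1 < n)%N ->
  (lucasP s t n)%:~R = b ^+ totient n * (map_poly intr (Cyclotomic n)).[a / b].
Proof.
move=> abs abt b0 n1; have [w pw] := C_prim_root_exists (ltnW n1).
have [_ /(_ n1 w pw)] := svalP (lucas_atom_exists n).
rewrite -(map_intHomPhi n1 pw) -/(lucas_atom_poly n).
move=> /(congr1 (meval (tnth [tuple a; b]))).
rewrite comp_mpoly_meval /lucasP.
rewrite -(@meval_map_mpoly _ _ (intr : {rmorphism int -> algC})) => E.
rewrite -(meval_eq (v1 := fun i =>
  (tnth [tuple 'X_0 + 'X_1; - ('X_0 * 'X_1)] i).@[tnth [tuple a; b]])).
  rewrite E {E} /intHomPhi (raddf_sum (map_mpoly intr)) raddf_sum /=.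
  rewrite horner_coef.
  rewrite size_map_inj_poly // ?size_Cyclotomic //; last exact: intr_inj.
  rewrite mulr_sumr; apply: eq_bigr => i _.
  rewrite map_mpolyZ rmorphM !rmorphXn /= !map_mpolyX mevalZ mevalM.
  rewrite !rmorphXn /= !mevalXU !(tnth_nth 0) /= coef_map /= [RHS]mulrCA.
  congr (_ * _).
  rewrite exprMn exprVn mulrCA; congr (_ * _).
  by rewrite -expfB_cond // (negPf b0) add0n -ltnS.
case=> -[|[|//]] lt_i; rewrite !(tnth_nth 0) /=.
  by rewrite mevalD !mevalXU !(tnth_nth 0).
by rewrite mevalN mevalM !mevalXU !(tnth_nth 0) /= abt opprK.
Qed.

(** * Cyclotomic factorization of [(X^(mq) - 1) / (X^m - 1)] and products of atoms *)

Lemma mul_prod_Cyclotomic m q : (0 < m)%N -> (0 < q)%N ->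
  ('X^m - 1) * \prod_(d <- divisors (m * q) | ~~ (d %| m)%N) Cyclotomic d
    = 'X^(m * q) - 1 :> {poly int}.
Proof.
move=> m0 q0; have mq0 : (0 < m * q)%N by rewrite muln_gt0 m0.
rewrite -!prod_Cyclotomic // [RHS](bigID (fun d => d %| m)%N) /=; congr (_ * _).
rewrite -[RHS]big_filter; apply: perm_big.
apply: uniq_perm; rewrite ?filter_uniq ?divisors_uniq // => d.
rewrite mem_filter -!dvdn_divisors //.
by case: (boolP (d %| m)%N) => // dm; rewrite dvdn_mulr.
Qed.

Lemma prod_Cyclotomic_ndvd m q : (0 < m)%N -> (0 < q)%N ->
  \prod_(d <- divisors (m * q) | ~~ (d %| m)%N) Cyclotomic d
    = \sum_(i < q) 'X^m ^+ i :> {poly int}.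
Proof.
move=> m0 q0; have X0 : 'X^m - 1 != 0 :> {poly int}.
  by rewrite monic_neq0 // monicXnsubC.
by apply: (mulfI X0); rewrite mul_prod_Cyclotomic // -subrX1 exprM.
Qed.

(** Comparison of degrees in [mul_prod_Cyclotomic]. It gives the power of [b] collected when the
    formulas of [lucasP_Cyclotomic] are multiplied. *)
Lemma sum_totient_ndvd m q : (0 < m)%N -> (0 < q)%N ->
  (\sum_(d <- divisors (m * q) | ~~ (d %| m)%N) totient d = m * q.-1)%N.
Proof.
move=> m0 q0; have := congr1 (fun r : {poly int} => size r)
  (mul_prod_Cyclotomic m q m0 q0).
have P1 : \prod_(d <- divisors (m * q) | ~~ (d %| m)%N) Cyclotomic d \is monic.
  by apply: monic_prod => d _; apply: Cyclotomic_monic.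
rewrite /= size_Mmonic // ?monic_neq0 ?monicXnsubC //.
rewrite !size_XnsubC ?muln_gt0 ?m0 // addSn /=.
rewrite -[\prod_(_ <- _ | _) _]big_filter -[X in _ -> X = _]big_filter.
rewrite size_prod_seq; last by move=> d _; rewrite monic_neq0 ?Cyclotomic_monic.
under eq_bigr do rewrite size_Cyclotomic -addn1.
rewrite big_split /= sum1_size -addSn addnK addnS -subn1 mulnBr muln1.
by case=> E; rewrite -[in RHS]E addKn.
Qed.

Lemma prod_lucasP (s t : int) m q : t != 0 -> (0 < m)%N -> (0 < q)%N ->
  \prod_(d <- divisors (m * q) | ~~ (d %| m)%N) lucasP s t d
    = lucasU (lucasV s t m) (- (- t) ^+ m) q.
Proof.
move=> t0 m0 q0; apply: (@intr_inj algC).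
pose D : algC := sqrtC (s%:~R ^+ 2 + 4 * t%:~R).
pose a := (s%:~R + D) / 2; pose b := (s%:~R - D) / 2.
have abs : a + b = s%:~R by rewrite /a /b; field.
have abt : a * b = - t%:~R.
  have DD : D ^+ 2 = s%:~R ^+ 2 + 4 * t%:~R by rewrite sqrtCK.
  have -> : a * b = (s%:~R ^+ 2 - D ^+ 2) / 4 by rewrite /a /b; field.
  by rewrite DD; field.
have b0 : b != 0.
  by apply: contra_neq t0 => b0; apply/(@intr_inj algC)/oppr_inj;
    rewrite -abt b0 mulr0 oppr0.
clearbody a b.
(* The quotient sequence has roots [a^m] and [b^m], with sum [V_m] and product [(-t)^m]. *)
rewrite (lucasU_binet (a ^+ m) (b ^+ m)); first last.
- by rewrite -exprMn abt rmorphN opprK rmorphXn rmorphN.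
- exact: lucasV_binet.
rewrite rmorph_prod /=.
transitivity (\prod_(d <- divisors (m * q) | ~~ (d %| m)%N)
   (b ^+ totient d * (map_poly intr (Cyclotomic d)).[a / b])).
  rewrite !(big_seq_cond (fun d => ~~ (d %| m)%N)); apply: eq_bigr => d.
  rewrite -dvdn_divisors ?muln_gt0 ?m0 // => /andP[dq dm].
  apply: lucasP_Cyclotomic => //.
  (* [d = 1] divides [m] and [d = 0] does not divide [m * q], so every index is at least 2. *)
  by case: d dq dm => [|[|d]] //; rewrite ?dvd1n // dvd0n muln_eq0 !gtn_eqF.
rewrite big_split /= -expr_sum sum_totient_ndvd // -horner_prod -rmorph_prod /=.
rewrite prod_Cyclotomic_ndvd // rmorph_sum horner_sum mulr_sumr.
rewrite (reindex_inj rev_ord_inj).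
apply: eq_bigr => i _ /=.
rewrite !rmorphXn /= map_polyX !hornerE.
have iq : (i <= q.-1)%N by rewrite -ltnS prednK.
have -> : (q - i.+1 = q.-1 - i)%N by rewrite -subn1 -subnDA add1n.
rewrite -{1}(subnK iq) mulnDr exprD mulrAC -!exprM -exprMn [b * _]mulrC.
by rewrite divfK.
Qed.

(** * Prime divisors and valuations of integers *)

Lemma Euclid_dvdzM (p : nat) (x y : int) : prime p ->
  (p %| x * y)%Z = (p %| x)%Z || (p %| y)%Z.
Proof. by move=> pp; rewrite !dvdzE abszM Euclid_dvdM. Qed.

Lemma Euclid_dvdzX (p : nat) (x : int) n : prime p ->
  (p %| x ^+ n)%Z = (p %| x)%Z && (0 < n)%N.
Proof. by move=> pp; rewrite !dvdzE abszX Euclid_dvdX. Qed.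

Lemma Euclid_dvdz_prod (I : eqType) (r : seq I) (P : pred I) (F : I -> int)
    (p : nat) : prime p ->
  (p %| \prod_(i <- r | P i) F i)%Z ->
  exists2 i, i \in r & P i && (p %| F i)%Z.
Proof.
move=> pp; elim: r => [|x r IH].
  by rewrite big_nil dvdzE Euclid_dvd1.
rewrite big_cons; case: ifP => [Px|_].
  rewrite Euclid_dvdzM // => /orP[dx|/IH[i ir di]].
    by exists x; rewrite ?mem_head // Px.
  by exists i; rewrite // in_cons ir orbT.
by case/IH => i ir di; exists i; rewrite // in_cons ir orbT.
Qed.

Lemma dvd_prime_natz (p q : nat) : prime p -> prime q ->
  (p %| q%:R)%Z = (p == q).
Proof. by move=> pp pq; rewrite natz dvdzE dvdn_prime2. Qed.

(** The case [x = 0] is included, both valuations then being infinite; this serves when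
    [U_k = 0]. *)
Lemma vp_mulr_coprime p x y : prime p -> ~~ (p %| y)%Z -> vp p (x * y) = vp p x.
Proof.
move=> pp py; have y0 : y != 0 by apply: contraNneq py => ->; rewrite dvdz0.
rewrite /vp mulf_eq0 (negPf y0) orbF; case: eqP => // /eqP x0.
rewrite abszM lognM ?absz_gt0 // [logn p `|y|]lognE pp absz_gt0 y0 /=.
by rewrite dvdzE in py; rewrite (negPf py) addn0.
Qed.

Lemma vp_ndvd (p : nat) x : prime p -> ~~ (p %| x)%Z -> vp p x = Some 0%N.
Proof.
move=> pp px; rewrite -[x]mul1r vp_mulr_coprime // /vp /=.
by rewrite logn1.
Qed.

Lemma vp_eq1 (p : nat) x : prime p -> (p %| x)%Z -> ~~ (p%:Z ^+ 2 %| x)%Z ->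
  vp p x = Some 1%N.
Proof.
move=> pp px ppx.
have x0 : x != 0 by apply: contraNneq ppx => ->; rewrite dvdz0.
rewrite /vp (negPf x0); congr Some; apply/eqP; rewrite eqn_leq.
rewrite dvdzE in px; rewrite dvdzE abszX in ppx.
by rewrite leqNgt -!pfactor_dvdn ?absz_gt0 ?px ?andbT.
Qed.

(** * Rank of appearance and divisibility by [p] *)

Section Valuation.

Variables (s t : int) (p k : nat).
Hypotheses (p_pr : prime p) (p_gt2 : (2 < p)%N) (pNt : ~~ (p %| t)%Z).
Hypothesis (k_rank : is_rank p (lucasU s t) k).

Local Notation U := (lucasU s t).
Local Notation V := (lucasV s t).
Local Notation P := (lucasP s t).

Let k_gt0 : (0 < k)%N. Proof. by case: k_rank. Qed.

Let t_neq0 : t != 0.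
Proof. by apply: contraNneq pNt => ->; rewrite dvdz0. Qed.

Let pNtX n : ~~ (p %| (- t) ^+ n)%Z.
Proof. by rewrite Euclid_dvdzX // negb_and rpredN pNt. Qed.

Let pN2X n : ~~ (p %| 2 ^+ n)%Z.
Proof. by rewrite Euclid_dvdzX // dvd_prime_natz // gtn_eqF. Qed.

(** By the Cassini identity, a common divisor of two consecutive terms divides [(-t)^n]. *)
Lemma dvd_lucasU_succ n : (p %| U n)%Z -> ~~ (p %| U n.+1)%Z.
Proof.
move=> pUn; apply: contra (pNtX n) => pUn1.
rewrite -(lucasU_cassini s t) !expr2 -mulrA.
by rewrite !rpredB // dvdz_mull // dvdz_mull.
Qed.

(** The addition formula gives [U_(n+k) = U_n U_(k+1)] modulo [p], and [U_(k+1)] is a unit there. *)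
Lemma dvd_lucasU_addk n : (p %| U (n + k))%Z = (p %| U n)%Z.
Proof.
have [_ pUk _] := k_rank.
case: n => [|n]; first by rewrite add0n pUk dvdz0.
rewrite addSn lucasUD rpredDr; last by rewrite dvdz_mull.
by rewrite Euclid_dvdzM // (negPf (dvd_lucasU_succ _ pUk)) orbF.
Qed.

Lemma dvd_lucasU n : (p %| U n)%Z = (k %| n)%N.
Proof.
have [_ pUk kmin] := k_rank.
rewrite {1}(divn_eq n k) /dvdn; elim: (n %/ k)%N => [|m IH]; last first.
  by rewrite mulSnr addnAC dvd_lucasU_addk.
rewrite add0n; case: posnP => [->|r_gt0]; first by rewrite dvdz0.
apply/negbTE/negP => /(kmin _ r_gt0).
by rewrite leqNgt ltn_pmod.
Qed.

(** * The quotient sequence modulo [p^2] *)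

Lemma p2_dvd_discriminant m : (k %| m)%N ->
  (p%:Z ^+ 2 %| V m ^+ 2 + 4 * (- (- t) ^+ m))%Z.
Proof.
rewrite -dvd_lucasU => pU.
by rewrite lucasV_discriminant dvdz_mull // dvdz_exp2r.
Qed.

(** Otherwise [p] would divide [4 (-t)^m], by the discriminant identity; [p] is odd and prime to
    [t]. *)
Lemma ndvd_lucasV m : (k %| m)%N -> ~~ (p %| V m)%Z.
Proof.
move=> km; apply: contra (pNtX m) => pV.
have := p2_dvd_discriminant m km.
move=> /(dvdz_trans (dvdz_exp (ltn0Sn 1) (dvdzz p))).
rewrite rpredDl; last by rewrite dvdz_exp.
by rewrite mulrN rpredN Euclid_dvdzM // (negPf (pN2X 2)).
Qed.

Lemma lucas_quotient_mod_p2 m q : (k %| m)%N ->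
  (p%:Z ^+ 2 %| V m * 2 ^+ q * lucasU (V m) (- (- t) ^+ m) q
             - 2 * q%:R * V m ^+ q)%Z.
Proof.
move=> /p2_dvd_discriminant/dvdz_trans; apply.
exact: lucasU_mod_discriminant.
Qed.

(** Modulo [p] the [q]-th term [W] satisfies [V_m 2^q W = 2 q V_m^q], where [2] and [V_m] are
    units. *)
Lemma dvd_lucas_quotient m q : (k %| m)%N -> prime q ->
  (p %| lucasU (V m) (- (- t) ^+ m) q)%Z = (p == q).
Proof.
move=> km q_pr; have pVm := ndvd_lucasV m km.
have := lucas_quotient_mod_p2 m q km.
move=> /(dvdz_trans (dvdz_exp (ltn0Sn 1) (dvdzz p))) H.
have -> : (p %| lucasU (V m) (- (- t) ^+ m) q)%Z =
          (p %| V m * 2 ^+ q * lucasU (V m) (- (- t) ^+ m) q)%Z.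
  by rewrite !Euclid_dvdzM // (negPf pVm) (negPf (pN2X q)).
rewrite -[X in (_ %| X)%Z](subrK (2 * q%:R * V m ^+ q)) rpredDl //.
rewrite 2?Euclid_dvdzM // Euclid_dvdzX // (negPf pVm) (negPf (pN2X 1)) orbF.
exact: dvd_prime_natz.
Qed.

Lemma vp_lucas_quotient m : (k %| m)%N ->
  vp p (lucasU (V m) (- (- t) ^+ m) p) = Some 1%N.
Proof.
move=> km; have pVm := ndvd_lucasV m km.
apply: vp_eq1 => //; first by rewrite dvd_lucas_quotient.
apply/negP => p2.
(* If [p^2] divided the [p]-th term, the congruence would give this, hence [p] would divide
   [2 V_m^p]. *)
have : (p%:Z ^+ 2 %| 2 * p%:R * V m ^+ p)%Z.
  rewrite -(rpredBl _ (dvdz_mull (V m * 2 ^+ p) p2)).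
  exact: lucas_quotient_mod_p2.
rewrite [2 * _]mulrC -mulrA [p%:R]natz expr2 dvdz_mul2l.
  by rewrite Euclid_dvdzM // Euclid_dvdzX // (negPf pVm) (negPf (pN2X 1)).
by rewrite -lt0n prime_gt0.
Qed.

(** * Valuations of the atoms *)

(** The case [m = 1] of [prod_lucasP]: since [V_1 = s] and [-(-t)^1 = t], the quotient sequence is
    [U] itself. *)
Lemma prod_lucasP_lucasU n : (0 < n)%N ->
  \prod_(d <- divisors n | (d != 1)%N) P d = U n.
Proof.
move=> n_gt0; have := prod_lucasP s t 1 n t_neq0 isT n_gt0.
rewrite mul1n /lucasV /= expr1 opprK.
have -> : 2 * (s * 1 + t * 0) - s * 1 = s by ring.
by move=> <-; apply: eq_bigl => d; rewrite dvdn1.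
Qed.

Lemma dvd_lucasP d : (p %| P d)%Z -> (0 < d)%N -> (k %| d)%N.
Proof.
move=> pP d_gt0; rewrite -dvd_lucasU -prod_lucasP_lucasU //.
case: (eqVneq d 1%N) pP => [-> | d1 pP].
  rewrite /lucasP /lucas_atom_poly.
  have [/(_ erefl) -> _] := svalP (lucas_atom_exists 1).
  by rewrite meval1 dvdzE Euclid_dvd1.
by rewrite (big_rem d) -?dvdn_divisors //= d1 dvdz_mulr.
Qed.

(** A factor [P d] divisible by [p] has [k] dividing [d], so every factor other than [P n] is prime
    to [p]. *)
Lemma vp_prod_lucasP n (A : pred nat) : (0 < n)%N -> A n ->
  (forall d, (d %| n)%N -> A d -> (k %| d)%N -> d = n) ->
  vp p (\prod_(d <- divisors n | A d) P d) = vp p (P n).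
Proof.
move=> n_gt0 An uniq_n; rewrite (big_rem n) -?dvdn_divisors //= An.
apply: vp_mulr_coprime => //.
apply/negP => /(Euclid_dvdz_prod _ _ _ _ _ p_pr)[d].
rewrite mem_rem_uniq ?divisors_uniq // inE -dvdn_divisors //.
move=> /andP[/eqP dn dvd_dn] /andP[Ad /dvd_lucasP kd]; apply: dn.
by apply: uniq_n => //; apply: kd; apply: dvdn_gt0 dvd_dn.
Qed.

Lemma vp_lucasP_rank : vp p (P k) = vp p (U k).
Proof.
rewrite -prod_lucasP_lucasU // vp_prod_lucasP //.
  (* The factor [P k] does occur in the product: [k] is not 1 because [U_1 = 1]. *)
  have [_ pUk _] := k_rank; apply/negP => /eqP k1; move: pUk.
  by rewrite k1 dvdzE Euclid_dvd1.
by move=> d dk _ kd; apply/eqP; rewrite eqn_dvd dk.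
Qed.

Lemma vp_lucasP_rank_pfactor h : (0 < h)%N -> vp p (P (k * p ^ h)) = Some 1%N.
Proof.
case: h => // h _; have p_gt0 := prime_gt0 p_pr.
have n_gt0 : (0 < k * p ^ h)%N by rewrite muln_gt0 k_gt0 expn_gt0 p_gt0.
rewrite -(vp_lucas_quotient (k * p ^ h)) ?dvdn_mulr //.
rewrite -prod_lucasP // -mulnA -expnSr.
rewrite (vp_prod_lucasP _ (fun d => ~~ (d %| k * p ^ h)%N)) //.
- by rewrite muln_gt0 k_gt0 expn_gt0 p_gt0.
- by rewrite dvdn_pmul2l // dvdn_Pexp2l ?prime_gt1 // ltnn.
(* Here [h] is the original exponent minus one. Writing [d = e * k], [e] divides [p^(h+1)] but not
   [p^h], so [e = p^(h+1)]. *)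
move=> d dn dNm /dvdnP[e de]; move: dn dNm; rewrite {d}de mulnC !dvdn_pmul2l //.
case/dvdn_pfactor => // i; rewrite leq_eqVlt => /predU1P[-> -> //|].
by rewrite ltnS => ih ->; rewrite dvdn_exp2l.
Qed.

Lemma vp_lucasP_other n : (0 < n)%N -> n <> k ->
  ~ (exists2 h : nat, (1 <= h)%N & n = (k * p ^ h)%N) -> vp p (P n) = Some 0%N.
Proof.
move=> n_gt0 nk nkp; apply: vp_ndvd => //; apply/negP => pP.
have /dvdnP[m nm] := dvd_lucasP n pP n_gt0.
have m_gt0 : (0 < m)%N by move: n_gt0; rewrite nm muln_gt0 => /andP[].
(* If [p] were the only prime factor of [m], then [m = p^h]; exponent 0 means [n = k], and the
   others are excluded by [nkp]. *)
have /allPn[q] : ~~ all (pred1 p) (primes m).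
  apply/negP => /allP pm; have /p_natP[h mh] : p.-nat m.
    by apply/pnatP => // q q_pr qm; apply: pm; rewrite mem_primes q_pr m_gt0.
  case: h mh => [|h] mh; first by apply: nk; rewrite nm mh mul1n.
  by apply: nkp; exists h.+1; rewrite // nm mulnC mh.
rewrite mem_primes m_gt0 /= => /andP[q_pr /dvdnP[l ml]] /= qp.
have l_gt0 : (0 < l)%N by move: m_gt0; rewrite ml muln_gt0 => /andP[].
have nE : n = (l * k * q)%N by rewrite nm ml mulnAC.
have lk_gt0 : (0 < l * k)%N by rewrite muln_gt0 l_gt0 k_gt0.
(* As [n = l k q] does not divide [l k], [P n] is a factor of the [q]-th quotient term, which is
   prime to [p] because [q] differs from [p]. *)
have := dvd_lucas_quotient (l * k) q (dvdn_mull _ (dvdnn k)) q_pr.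
rewrite [RHS]eq_sym (negPf qp) -prod_lucasP // ?prime_gt0 // -nE.
rewrite (big_rem n) -?dvdn_divisors //=.
have -> : ~~ (n %| l * k)%N.
  by rewrite nE gtnNdvd // -[X in (X < _)%N]muln1 ltn_pmul2l // prime_gt1.
by rewrite dvdz_mulr.
Qed.

End Valuation.

Theorem theorem14 (s t : int) (p : nat) (hp : prime p) (hp3 : (3 <= p)%N)
    (hpt : ~~ (p %| t)%Z) (k : nat) (hk : is_rank p (lucasU s t) k)
    (n : nat) (hn : (1 <= n)%N) :
  [/\ n = k -> vp p (lucasP s t n) = vp p (lucasU s t k),
      (exists2 h : nat, (1 <= h)%N & n = (k * p ^ h)%N) ->
        vp p (lucasP s t n) = Some 1%N
    & n <> k -> ~ (exists2 h : nat, (1 <= h)%N & n = (k * p ^ h)%N) ->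
        vp p (lucasP s t n) = Some 0%N].
Proof.
split=> [->|[h h_gt0 ->]|nk nkp].
- exact: vp_lucasP_rank.
- exact: vp_lucasP_rank_pfactor.
exact: (vp_lucasP_other s t p k).
Qed.
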